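(* Let $k\ge 1$. In the ordered chain game on the $2$-dimensional $k$-wedge $W^2_k$, Walker has a strategy to build a chain of size $\lceil 2k/3\rceil$ using only his first $\lceil 2k/3\rceil$ moves, and Blocker has a strategy preventing Walker from building a chain of size larger than $\lceil 2k/3\rceil$.
   Context: $W^2_k$ is the poset of pairs $(a,b)$ of nonnegative integers with $a+b<k$, ordered coordinatewise. In the ordered chain game (Walker-Blocker game) on a finite poset, Walker and Blocker alternately (Walker first) choose previously unchosen elements until all are chosen. Walker builds a chain of size $m$ if there are elements $x_1\prec\cdots\prec x_m$ all chosen by Walker, chosen in this order in time. *)

(* Defs.v *)
From HB Require Import structures.
From mathcomp Require Import all_boot all_order all_algebra.

Set Implicit Arguments.
Unset Strict Implicit.
Unset Printing Implicit Defensive.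

Import Order.TTheory.

(* Both coordinates of a pair (a, b) with a + b < k are < k, so nothing is lost
   by taking them in 'I_k, which makes the type finite. *)
Record wedge (k : nat) := Wedge {
  wedge_pair : 'I_k *p 'I_k;
  _ : wedge_pair.1 + wedge_pair.2 < k
}.

Fact wedge_display : Order.disp_t. Proof. exact: Order.Disp tt tt. Qed.

HB.instance Definition _ k := [isSub for @wedge_pair k].
HB.instance Definition _ k := [Finite of wedge k by <:].
HB.instance Definition _ k :=
  [SubChoice_isSubPOrder of wedge k by <: with wedge_display].

Lemma wedge_leE k (x y : wedge k) :
  (x <= y)%O = ((wedge_pair x).1 <= (wedge_pair y).1)
            && ((wedge_pair x).2 <= (wedge_pair y).2).
Proof. by []. Qed.

Section OrderedChainGame.
Context {disp : Order.disp_t} {T : finPOrderType disp}.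
Implicit Types (h c : seq T) (turn : pred (seq T)).

(* A history lists the elements chosen so far, by either player, in order of
   time; Walker moves first, hence after histories of even size. *)
Definition walker_turn h := ~~ odd (size h).
Definition blocker_turn h := odd (size h).

Definition complete_play h := uniq h && (size h == #|T|).

(* A strategy gives the element to choose after each history. Its value is
   meaningful only when it is the player's turn and some element is free. *)
Definition strategy := seq T -> T.

Definition legal turn (s : strategy) :=
  forall h, uniq h -> size h < #|T| -> turn h -> s h \notin h.

Definition follows turn (s : strategy) h :=
  forall p x, prefix (rcons p x) h -> turn p -> x = s p.

Fixpoint walker_moves h : seq T :=
  match h with
  | [::] => [::]
  | [:: x] => [:: x]
  | [:: x, _ & h'] => x :: walker_moves h'
  end.

(* The moves are listed in order of time, so a subsequence that is increasing
   in the poset is a chain chosen from bottom to top. *)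
Definition builds_chain (moves : seq T) (m : nat) :=
  exists c, [/\ size c = m, sorted <%O c & subseq c moves].

End OrderedChainGame.

Arguments strategy {disp} T.

Definition walker_can_build_within disp (T : finPOrderType disp) (m n : nat) :=
  exists s : strategy T, legal walker_turn s /\
    forall h : seq T, complete_play h -> follows walker_turn s h ->
      builds_chain (take n (walker_moves h)) m.

Definition blocker_can_prevent_above disp (T : finPOrderType disp) (m : nat) :=
  exists s : strategy T, legal blocker_turn s /\
    forall h : seq T, complete_play h -> follows blocker_turn s h ->
      forall m', m < m' -> ~ builds_chain (walker_moves h) m'.

(* Main.v *)
(** Walker keeps extending his chain by one element per move. His potential is the
    expected number of taken points met by a uniform random up-right walk from his
    last point. Each Blocker move raises it by at most 1/2, and moving to the
    better neighbour never raises it; when that neighbour is taken, Walker skips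
    it, which costs one rank but lowers the potential by 1. As the potential is
    nonnegative, at most [n / 2] ranks have been skipped after [n + 1] moves.

    Blocker answers a point [x] whose rank is divisible by 3 with the point
    diagonally above [x], and any other point with a free cover of it. Then Walker
    never climbs through three consecutive ranks [3t], [3t + 1], [3t + 2], so the
    [j]-th element of his chain (from 0) has rank at least [j + j / 2]. *)

Require Import Defs.
From mathcomp Require Import all_boot all_order all_algebra.
From mathcomp Require Import zify lra.

Set Implicit Arguments.
Unset Strict Implicit.
Unset Printing Implicit Defensive.

Import Order.TTheory GRing.Theory Num.Theory.

(** * Greedy strategies and the timing of moves *)

Section Plays.
Context {disp : Order.disp_t} {T : finPOrderType disp}.
Implicit Types (h : seq T) (good : seq T -> pred T).

(** Both players' strategies have this form. The fallback keeps play legal when no free element is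
    [good]; [x0] is returned only once everything is taken. *)
Definition greedy (x0 : T) good : strategy T := fun h =>
  if [pick y | (y \notin h) && good h y] is Some y then y
  else odflt x0 [pick y | y \notin h].

Lemma greedy_legal turn x0 good : legal turn (greedy x0 good).
Proof.
move=> h _ szh _; rewrite /greedy.
case: pickP => [y /andP[]//|_]; case: pickP => //= allh.
suff: #|T| <= size h by rewrite leqNgt szh.
apply: leq_trans (card_size h); apply/subset_leq_card/subsetP => y _.
exact: negbFE (allh y).
Qed.

Lemma greedyP x0 good h y : y \notin h -> good h y ->
  greedy x0 good h \notin h /\ good h (greedy x0 good h).
Proof.
move=> yh gy; rewrite /greedy; case: pickP => [z /andP[]//|/(_ y)].
by rewrite yh gy.
Qed.

Lemma complete_play_mem h x : complete_play h -> x \in h.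
Proof.
move=> /andP[uh /eqP szh]; apply/negPn/negP => xh.
have: #|x :: h| <= #|T| by apply: max_card.
by rewrite (card_uniqP _) /= ?xh // szh ltnn.
Qed.

Lemma follows_nth turn s h x0 i : follows turn s h -> i < size h ->
  turn (take i h) -> nth x0 h i = s (take i h).
Proof. by move=> fs ih; apply: fs; rewrite -take_nth // prefix_take. Qed.

Lemma follows_reply s h x : follows blocker_turn s h -> uniq h ->
    ~~ odd (index x h) -> (index x h).+1 < size h ->
  index (s (take (index x h).+1 h)) h = (index x h).+1.
Proof.
move=> fh uh ox xh; rewrite -(follows_nth x fh xh) ?index_uniq //.
by rewrite /blocker_turn (size_takel (ltnW xh)).
Qed.

Lemma walker_movesE x0 h :
  walker_moves h = [seq nth x0 h i.*2 | i <- iota 0 (uphalf (size h))].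
Proof.
have [n] := ubnP (size h); elim: n h => // n IHn [|x [|y h]] //= szh.
rewrite IHn; last by lia.
by rewrite -[1]/(1 + 0) iotaDl -map_comp.
Qed.

Lemma walker_moves_subseq h : subseq (walker_moves h) h.
Proof.
have [n] := ubnP (size h); elim: n h => // n IHn [|x [|y h]] //= szh.
  by rewrite eqxx.
rewrite eqxx; apply: subseq_trans (subseq_cons h y).
by apply: IHn; lia.
Qed.

Lemma walker_moves_even h x : uniq h -> x \in walker_moves h ->
  ~~ odd (index x h).
Proof.
move=> uh; rewrite (walker_movesE x) => /mapP[i].
rewrite mem_iota => /andP[_ ilt] ->; rewrite index_uniq ?odd_double //.
by rewrite -gtn_uphalf_double.
Qed.

Lemma sorted_index h : uniq h -> sorted (fun x y => index x h < index y h) h.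
Proof.
case: h => // x0 h uh; apply/(sortedP x0) => i ilt.
by rewrite !index_uniq // ltnW.
Qed.

End Plays.

(** * Coordinates, rank and covers in the wedge *)

Section Wedge.
Variable k : nat.
Implicit Types (x y z : wedge k) (h : seq (wedge k)).

Definition coords x : nat * nat := ((wedge_pair x).1 : nat, (wedge_pair x).2 : nat).
Definition rank x : nat := (coords x).1 + (coords x).2.

Lemma coords_inj : injective coords.
Proof.
move=> x y [e1 e2]; apply: val_inj => /=; move: e1 e2.
by case: (wedge_pair x) (wedge_pair y) => [a b] [c d] /= e1 e2; congr (_, _); apply: val_inj.
Qed.

Lemma rank_lt x : rank x < k.
Proof. by case: x => p. Qed.

Lemma wedge_exists a b : a + b < k -> exists x, coords x = (a, b).
Proof.
move=> abk; have ak : a < k by lia. have bk : b < k by lia.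
by exists (@Wedge k (Ordinal ak, Ordinal bk) abk).
Qed.

(** Comparable points of equal rank coincide, so strictness can be read off the ranks. *)
Lemma wedge_ltP x y : reflect
  [/\ (coords x).1 <= (coords y).1, (coords x).2 <= (coords y).2
    & rank x < rank y] (x < y)%O.
Proof.
have -> : (x < y)%O = [&& y != x, (coords x).1 <= (coords y).1
    & (coords x).2 <= (coords y).2] by rewrite lt_def.
rewrite -(inj_eq coords_inj) /rank.
case: (coords x) (coords y) => [a b] [c d] /=; rewrite xpair_eqE.
apply: (iffP and3P) => -[]; rewrite ?negb_and; last by move=> *; split; lia.
by case/orP=> *; split; lia.
Qed.

Lemma wedge_cover x y : (x < y)%O -> rank y = (rank x).+1 ->
  coords y = ((coords x).1.+1, (coords x).2) \/
  coords y = ((coords x).1, (coords x).2.+1).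
Proof.
case/wedge_ltP; rewrite /rank.
case: (coords x) (coords y) => [a b] [c d] /= ac bd _ e.
by have [ca|ca] := eqVneq c a; [right|left]; congr (_, _); lia.
Qed.

(** * Blocker *)

Definition blocker_good h z : bool :=
  let x := last z h in
  if 3 %| rank x then coords z == ((coords x).1.+1, (coords x).2.+1)
  else (x < z)%O && (rank z == (rank x).+1).

(* The diagonal point above [w] blocks one of the two covers of [x], and the
   answer to [x] blocks the other. *)
Lemma blocker_no_triple x0 h w x z :
    complete_play h -> follows blocker_turn (greedy x0 blocker_good) h ->
    ~~ odd (index w h) -> ~~ odd (index x h) -> ~~ odd (index z h) ->
    index w h < index x h -> index x h < index z h ->
    (w < x)%O -> (x < z)%O -> 3 %| rank w -> rank z = (rank w).+2 -> False.
Proof.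
move=> ch fh ow ox oz iwx ixz wx xz dw rz.
have hm y : y \in h by apply: complete_play_mem.
have sz y : index y h < size h by rewrite index_mem.
have {ch} uh : uniq h by case/andP: ch.
set s := greedy x0 blocker_good.
have ltk y u : ((index y h).+1 <= index u h) = (u \notin take (index y h).+1 h).
  by rewrite in_take // -leqNgt.
have lst y u : last u (take (index y h).+1 h) = y.
  by rewrite (take_nth u (sz y)) last_rcons (nth_index u (hm y)).
have answer y u : ~~ odd (index y h) -> index y h < index u h ->
    index (s (take (index y h).+1 h)) h = (index y h).+1.
  by move=> oy yu; apply: (follows_reply fh uh oy); apply: leq_ltn_trans yu (sz u).
have [_ _ rwx] := wedge_ltP _ _ wx.
have [_ _ rxz] := wedge_ltP _ _ xz.
have rx : rank x = (rank w).+1 by clear -rwx rxz rz; lia.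
have dx : (3 %| rank x) = false by rewrite rx; clear -dw; lia.
(* The diagonal point [d] has the rank of [z], hence lies in the wedge. *)
have [d cd] : exists d, coords d = ((coords w).1.+1, (coords w).2.+1).
  by apply: wedge_exists; have := rank_lt z; rewrite rz addSn addnS.
(* Either [d] is already taken when Walker chooses [w], or it is free and Blocker replies with it at
   once. *)
have idx : index d h <= index x h.
  have [dle|dgt] := leqP (index d h) (index w h).
    exact: leq_trans dle (ltnW iwx).
  have gd : blocker_good (take (index w h).+1 h) d.
    by rewrite /blocker_good lst dw cd.
  rewrite ltk in dgt.
  have [_] := greedyP x0 dgt gd; rewrite /blocker_good lst dw -cd.
  by move/eqP/coords_inj => e; have := answer _ _ ow iwx; rewrite /s e => ->.
have gz : blocker_good (take (index x h).+1 h) z.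
  by rewrite /blocker_good lst dx xz rz rx eqxx.
have zx := ixz; rewrite ltk in zx.
have [sn] := greedyP x0 zx gz; rewrite /blocker_good lst dx -/s => /andP[xs /eqP rs].
(* The reply to [x] has odd index, Walker's point [z] an even one. *)
have sneqz : s (take (index x h).+1 h) <> z.
  by move=> e; have := answer _ _ ox ixz; rewrite e => e'; move: oz; rewrite e' /= ox.
have dnz : d <> z by move=> e; move: idx; rewrite e leqNgt ixz.
have dns : d <> s (take (index x h).+1 h).
  by move=> e; move: sn; rewrite -/s -e -ltk ltnNge idx.
(* Now [d], [z] and the reply are pairwise distinct, but all three cover [x], which has at most two
   covers. *)
have xE := wedge_cover wx rx.
have zE := wedge_cover xz (etrans rz (congr1 S (esym rx))).
have sE := wedge_cover xs rs.
case: xE zE sE => [] xE [] zE [] sE;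
  solve [ by apply: sneqz; apply: coords_inj; rewrite zE sE
        | by apply: dnz; apply: coords_inj; rewrite cd zE xE
        | by apply: dns; apply: coords_inj; rewrite cd sE xE ].
Qed.

(** Two steps along the chain raise the rank by at least 2, and by at least 3 from a multiple of 3.
    Hence position [2j] has rank at least [3j]. *)
Lemma rank_lower_bound (c : seq (wedge k)) x0 :
    sorted <%O c ->
    (forall i, i.+2 < size c -> 3 %| rank (nth x0 c i) ->
       rank (nth x0 c i.+2) <> (rank (nth x0 c i)).+2) ->
  forall i, i < size c -> i + i./2 <= rank (nth x0 c i).
Proof.
move=> /(sortedP x0) sc triple i.
have step j : j.+1 < size c -> rank (nth x0 c j) < rank (nth x0 c j.+1).
  by move/sc/wedge_ltP => [].
have even j : j.*2 < size c -> 3 * j <= rank (nth x0 c j.*2).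
  elim: j => // j IHj; rewrite doubleS => jc.
  have j1 := ltnW jc; have j0 := ltnW j1.
  have := IHj j0; have := step _ j1; have := step _ jc; have := triple _ jc; lia.
move=> ic; have [oi|oi] := boolP (odd i).
  have iE : i = (i./2.*2).+1 by lia.
  have i1 : (i./2).*2.+1 < size c by rewrite -iE.
  rewrite [in rank _]iE; have := step _ i1; have := even _ (ltnW i1); lia.
have iE : i = i./2.*2 by lia.
rewrite [in rank _]iE; have := even i./2; rewrite -iE => /(_ ic); lia.
Qed.

Lemma blocker_prevents m : 0 < k -> 2 * k <= 3 * m ->
  blocker_can_prevent_above (wedge k) m.
Proof.
move=> k0 km; have [x0 _] := @wedge_exists 0 0 k0.
exists (greedy x0 blocker_good); split=> [|h ch fh m' mm' [c [szc sc cw]]].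
  exact: greedy_legal.
have uh : uniq h by case/andP: ch.
have ti : sorted (fun x y => index x h < index y h) c.
  apply: subseq_sorted (sorted_index uh); first by move=> y x z; apply: ltn_trans.
  exact: subseq_trans cw (walker_moves_subseq h).
have ev i : i < size c -> ~~ odd (index (nth x0 c i) h).
  by move=> ic; apply: walker_moves_even uh (mem_subseq cw _); apply: mem_nth.
have triple i : i.+2 < size c -> 3 %| rank (nth x0 c i) ->
    rank (nth x0 c i.+2) <> (rank (nth x0 c i)).+2.
  move=> ic di ri; move/(sortedP x0): ti => ti; move/(sortedP x0): sc => sc.
  have ic1 := ltnW ic; have ic0 := ltnW ic1.
  exact: (blocker_no_triple ch fh (ev _ ic0) (ev _ ic1) (ev _ ic)
    (ti _ ic1) (ti _ ic) (sc _ ic1) (sc _ ic)).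
have mc : m < size c by rewrite szc.
(* Here [m + m./2 >= k]: for odd [m], the odd number [3 * m] exceeds the even [2 * k], so rounding
   down is harmless. *)
have := rank_lower_bound sc triple mc; have := rank_lt (nth x0 c m).
by clear -km; lia.
Qed.

(** * Walker *)

(* The expected number of points of [S] met in the first [d] steps of a uniform
   random up-right walk from [(a, b)], which itself is not counted. *)
Fixpoint hits (S : seq (nat * nat)) d a b : rat :=
  if d is d'.+1 then
    ((((a.+1, b) \in S)%:R + hits S d' a.+1 b
      + (((a, b.+1) \in S)%:R + hits S d' a b.+1)) / 2%:R)%R
  else 0%R.

Lemma hits_ge0 S d a b : (0 <= hits S d a b)%R.
Proof.
elim: d a b => //= d IHd a b.
have := IHd a.+1 b; have := IHd a b.+1.
have : (0 <= ((a.+1, b) \in S)%:R :> rat)%R by [].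
have : (0 <= ((a, b.+1) \in S)%:R :> rat)%R by [].
lra.
Qed.

Lemma hits_nil d a b : hits [::] d a b = 0%R.
Proof. by elim: d a b => //= d IHd a b; rewrite !IHd; lra. Qed.

(** A walk meets [u] at most once, and only if [u] has larger rank. The probability is 1/2 when [u]
    is a neighbour of the start, and otherwise an average of two values at most 1/2. *)
Lemma hits_rcons S u d a b :
  (hits (rcons S u) d a b
   <= hits S d a b + (a + b < u.1 + u.2)%:R / 2%:R)%R.
Proof.
elim: d a b => [|d IHd] a b /=; first by rewrite add0r divr_ge0.
have memS v : ((v \in rcons S u)%:R <= (v \in S)%:R + (v == u)%:R :> rat)%R.
  by rewrite mem_rcons inE; case: (v == u) (v \in S) => [] [].
have := IHd a.+1 b; have := IHd a b.+1.
have := memS (a.+1, b); have := memS (a, b.+1); case: u {memS IHd} => u1 u2 /=.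
have : ((a.+1, b) == (u1, u2)) + ((a, b.+1) == (u1, u2)) + ((a + b).+1 < u1 + u2)
    <= (a + b < u1 + u2) by rewrite !xpair_eqE; lia.
by rewrite -(ler_nat rat) !natrD addSn addnS; lra.
Qed.

(** As [d + (a + b)] is preserved, the last bound says that [hits] plus rank grows by at most 1. The
    hypothesis yields a free point before the steps run out. *)
Lemma escape S d a b : (hits S d a b + 1 < d%:R)%R ->
  exists a' b' d', [/\ (a', b') \notin S, (a <= a') && (b <= b'),
    0 < d' < d, d' + (a' + b') = d + (a + b)
    & (hits S d' a' b' + d%:R <= hits S d a b + 1 + d'%:R)%R].
Proof.
elim: d a b => [|d IHd] a b.
  by have := hits_ge0 S 0 a b; rewrite mulr0n; lra.
set t := hits S d.+1 a b => tlt.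
(* The smaller of the two averaged terms is at most their average. *)
have [a1 [b1 [le1 le2 e1 tz]]] : exists a1 b1, [/\ a <= a1, b <= b1,
    a1 + b1 = (a + b).+1 & (((a1, b1) \in S)%:R + hits S d a1 b1 <= t)%R].
  have [le|gt] := lerP (((a.+1, b) \in S)%:R + hits S d a.+1 b)%R t.
    by exists a.+1, b.
  exists a, b.+1; split=> //; first by rewrite addnS.
  by move: gt; rewrite /t /=; lra.
have Sd : (d.+1%:R = d%:R + 1 :> rat)%R by rewrite -natr1.
have h0 := hits_ge0 S d a1 b1.
have [inS|ninS] := boolP ((a1, b1) \in S); last first.
  rewrite (negbTE ninS) mulr0n in tz.
  exists a1, b1, d; split=> //; [by rewrite le1| |by lia|by lra].
  by rewrite ltnSn andbT -(ltr_nat rat); lra.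
(* Skipping a taken neighbour costs one step but removes at least 1 from [hits], so the hypothesis
   survives. *)
rewrite inS mulr1n in tz.
have [|a2 [b2 [d2 [nS l2 d2d e2 t2]]]] := IHd a1 b1; first by lra.
exists a2, b2, d2; split=> //; try by lia.
by lra.
Qed.

(* A walk from [x] leaves the wedge after [k - rank x] steps. *)
Definition pot h x : rat := hits (map coords h) (k - rank x) (coords x).1 (coords x).2.

Lemma pot_rcons h z x :
  (pot (rcons h z) x <= pot h x + (rank x < rank z)%:R / 2%:R)%R.
Proof. by rewrite /pot map_rcons; apply: hits_rcons. Qed.

(* On Walker's turn the entry of index [(size h).-2] is his own last move. *)
Definition walker_good (x0 : wedge k) h y : bool :=
  if h is [::] then rank y == 0 else
  let x := nth x0 h (size h).-2 in
  (x < y)%O && (pot h y + (rank y)%:R <= pot h x + (rank x)%:R + 1)%R.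

Lemma walker_good_exists h x : (pot h x + (rank x)%:R + 1 < k%:R)%R ->
  exists y, [/\ y \notin h, (x < y)%O
    & (pot h y + (rank y)%:R <= pot h x + (rank x)%:R + 1)%R].
Proof.
have kE : (k%:R = (k - rank x)%:R + (rank x)%:R :> rat)%R.
  by rewrite -natrD subnK // ltnW // rank_lt.
move=> lt_k; have := @escape (map coords h) (k - rank x) (coords x).1 (coords x).2.
rewrite -/(pot h x) => /(_ _)[|a [b [d [nh /andP[lea leb] /andP[d0 dlt] e le]]]].
  by move: lt_k; rewrite kE; lra.
have rx := rank_lt x; rewrite -/(rank x) in e.
(* Since [d + (a + b) = k], positivity of [d] keeps [(a, b)] in the wedge. *)
have [y cy] : exists y, coords y = (a, b).
  by apply: wedge_exists; clear -rx e d0; lia.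
have ry : rank y = a + b by rewrite /rank cy.
exists y; split.
- by apply: contra nh => yh; rewrite -cy map_f.
- by apply/wedge_ltP; rewrite cy; split=> //; rewrite ry; clear -rx e dlt; lia.
have dE : d = k - rank y by rewrite ry; clear -rx e; lia.
have eE : (d%:R + (rank y)%:R = (k - rank x)%:R + (rank x)%:R :> rat)%R.
  by rewrite -!natrD ry e.
by rewrite /pot -dE cy /=; move: le; rewrite -/(pot h x); lra.
Qed.

(** After Walker's move [n], counted from 0, potential plus rank is at most [3n/2]: his move adds at
    most 1, Blocker's reply at most 1/2. He can extend while [3(n+1)/2 < k], which holds for
    [n + 1 < m]. *)
Lemma walker_builds m : 0 < k -> 3 * m < 2 * k + 3 ->
  walker_can_build_within (wedge k) m m.
Proof.
move=> k0 km; have [x0 cx0] := @wedge_exists 0 0 k0.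
set s := greedy x0 (walker_good x0).
exists s; split=> [|h ch fh]; first exact: greedy_legal.
pose w n := nth x0 h n.*2.
have move_in n : n.*2 < size h -> w n = s (take n.*2 h).
  by move=> nh; apply: (follows_nth x0 fh nh);
     rewrite /walker_turn (size_takel (ltnW nh)) odd_double.
(* Taking [w n] does not raise the potential at [w n], since only points of larger rank count. *)
have pot_move n : n.*2 < size h ->
    (pot (take n.*2.+1 h) (w n) <= pot (take n.*2 h) (w n))%R.
  move=> nh; rewrite (take_nth x0 nh); apply: le_trans (pot_rcons _ _ _) _.
  by rewrite ltnn mul0r addr0.
have inv n : n < m -> [/\ n.*2 < size h,
    (pot (take n.*2.+1 h) (w n) + (rank (w n))%:R <= 3%:R * n%:R / 2%:R)%R
    & forall n', n = n'.+1 -> (w n' < w n)%O].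
  elim: n => [|n IHn] nm.
    have h0 : 0 < size h.
      by case: (h) (complete_play_mem x0 ch).
    have g0 : walker_good x0 [::] x0 by rewrite /= /rank cx0.
    have [_] := @greedyP _ _ x0 (walker_good x0) [::] x0 isT g0.
    rewrite -/s => /eqP r0.
    have w0 : rank (w 0) = 0 by rewrite (move_in 0 h0) take0.
    split=> //; rewrite w0 mulr0n mulr0 mul0r addr0.
    apply: le_trans (pot_move 0 h0) _.
    by rewrite take0 /pot hits_nil.
  have [nh pw _] := IHn (ltnW nm).
  set h2 := take n.+1.*2 h.
  have Sn : (n.+1%:R = n%:R + 1 :> rat)%R by rewrite -natr1.
  have p2 : (pot h2 (w n) + (rank (w n))%:R + 1 <= 3%:R * n.+1%:R / 2%:R)%R.
    suff : (pot h2 (w n) <= pot (take n.*2.+1 h) (w n) + 1 / 2%:R)%R.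
      by move: pw; rewrite Sn; lra.
    (* If the play ends with [w n], there is no reply and the history is unchanged. *)
    rewrite /h2 doubleS; have [le|lt] := leqP (size h) n.*2.+1.
      by rewrite !take_oversize ?(leq_trans le) // lerDl divr_ge0.
    rewrite (take_nth x0 lt); apply: le_trans (pot_rcons _ _ _) _.
    by rewrite lerD2l ler_pM2r // lern1 leq_b1.
  have lt_k : (pot h2 (w n) + (rank (w n))%:R + 1 < k%:R)%R.
    have : 3 * n.+1 < 2 * k by clear -nm km; lia.
    by rewrite -(ltr_nat rat) !natrM; move: p2; lra.
  have [y [yh2 wy py]] := walker_good_exists lt_k.
  (* A complete play leaves no point free, but [y] is free after [h2]. *)
  have nh2 : n.+1.*2 < size h.
    rewrite ltnNge; apply/negP => le; move: yh2.
    by rewrite /h2 take_oversize // complete_play_mem.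
  have sz2 : size h2 = n.+1.*2 by rewrite /h2 (size_takel (ltnW nh2)).
  have good2 z : walker_good x0 h2 z = (w n < z)%O &&
      (pot h2 z + (rank z)%:R <= pot h2 (w n) + (rank (w n))%:R + 1)%R.
    have -> : w n = nth x0 h2 (size h2).-2 by rewrite sz2 /h2 nth_take // ltnW.
    by case: (h2) sz2.
  have [] := @greedyP _ _ x0 (walker_good x0) h2 y yh2; first by rewrite good2 wy.
  rewrite -/s -(move_in _ nh2) good2 => _ /andP[lt2 le2].
  split=> // [|n' [<-] //].
  have := pot_move _ nh2; rewrite -/h2; move: le2 p2; lra.
have szm : m <= size (walker_moves h).
  rewrite (walker_movesE x0) size_map size_iota.
  by case: (m) inv => // m' /(_ m' (ltnSn _))[lt _ _]; rewrite gtn_uphalf_double.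
exists (take m (walker_moves h)); split=> //; first exact: size_takel.
apply/(sortedP x0) => i; rewrite (size_takel szm) => im.
have [_ _ /(_ i erefl)] := inv _ im.
have im0 := ltnW im; rewrite !nth_take // (walker_movesE x0).
move: szm; rewrite (walker_movesE x0) size_map size_iota => szm.
have lt1 := leq_trans im szm; have lt0 := ltnW lt1.
by rewrite !(nth_map 0) ?size_iota // !nth_iota.
Qed.

End Wedge.

(** Blocker's bound uses the first inequality, Walker's the second. *)
Lemma ceil_two_thirds k (m := `|Num.ceil ((2 * k)%:R / 3%:R : rat)%R|%N) :
  2 * k <= 3 * m /\ 3 * m < 2 * k + 3.
Proof.
rewrite {}/m; set q : rat := (_ / _)%R.
have q0 : (0 <= q)%R by rewrite divr_ge0.
have c0 : (0 <= Num.ceil q)%R by rewrite ceil_ge0; lra.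
have := ceil_ge q; have := ceilB1_lt q; move: c0; case: (Num.ceil q) => // n _.
rewrite intrB mulr1z -pmulrn absz_nat -(ler_nat rat) -(ltr_nat rat) natrD !natrM.
rewrite /q natrM => lt le.
by split; lra.
Qed.

Theorem theorem5 (k : nat) (k_ge1 : 1 <= k) :
  let m := `|Num.ceil ((2 * k)%:R / 3%:R : rat)%R|%N in
  walker_can_build_within (wedge k) m m /\
  blocker_can_prevent_above (wedge k) m.
Proof.
move=> m; have [le ge] := ceil_two_thirds k.
by split; [apply: walker_builds | apply: blocker_prevents].
Qed.
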